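(* Let $\varphi:\mathbb{Z}^m\times\mathbb{Z}^m\to\mathbb{Z}^n$ be a full, alternating, bilinear map given by skew-symmetric matrices $A_1,\dots,A_n\in\mathbb{Z}^{m\times m}$, let $M_x=\sum_{i=1}^n x_iA_i$, and let $d\in\mathbb{N}$. If there exists a non-zero vector $v=(v_1,\dots,v_n)\in\mathbb{Z}^n$ such that $$\Big(\sum_{i=1}^n v_ix_i\Big)^d\in I_d(M_x)\subset\mathbb{Z}[x_1,\dots,x_n],$$ then $\log^{d+1}\preceq\mathrm{RF}_{G_\varphi}$.
   Context: $\mathbb{N}=\{1,2,\ldots\}$. For a matrix $M$ over a commutative ring, a $d\times d$ minor is the determinant of a $d\times d$ submatrix, and $I_d(M)$ is the ideal generated by all $d\times d$ minors of $M$; here $I_d(M_x)$ is an ideal of $\mathbb{Z}[x_1,\dots,x_n]$. Residual finiteness growth: let $G$ be a finitely generated residually finite group with finite generating set $S$, neutral element $e$, and word norm $\|\cdot\|_S$; put $B_S(r)=\{g\in G\mid \|g\|_S\le r\}$. Let $D_G(g)=\min\{[G:N]\mid g\notin N, N\lhd G\}$ for $g\ne e$, and $\mathrm{RF}_{G,S}(r)=\max\{D_G(g)\mid e\neq g\in B_S(r)\}$ for real $r\geq 1$. For non-decreasing functions on $\mathbb{R}_{\ge1}$, $f\preceq g$ means there is $C>0$ with $f(r)\le C g(Cr)$ for all $r\ge\max\{1,1/C\}$, and $f\approx g$ means $f\preceq g$ and $g\preceq f$. $\mathrm{RF}_G$ is the $\approx$-class of $\mathrm{RF}_{G,S}$ (independent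 of $S$); $\log^k$ is $r\mapsto(\log r)^k$. The groups $G_\varphi$: a bilinear map $\varphi:\mathbb{Z}^m\times\mathbb{Z}^m\to\mathbb{Z}^n$ is alternating if $\varphi(w,w')=-\varphi(w',w)$ for all $w,w'$, and full if its values generate a finite index subgroup of $\mathbb{Z}^n$. That it is given by $A_1,\dots,A_n$ means $\varphi(w,w')=(w^TA_1w',\dots,w^TA_nw')^T$. Let $A_i^L$ be $A_i$ with its upper triangular part set to zero, and $\varphi^L(w,w')=(w^TA_1^Lw',\dots,w^TA_n^Lw')^T$. $G_\varphi$ is the set $\mathbb{Z}^m\times\mathbb{Z}^n$ with product $(w_1,v_1)(w_2,v_2)=(w_1+w_2,v_1+v_2+\varphi^L(w_1,w_2))$; it is a torsion-free, finitely generated, two-step nilpotent group. *)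

(* Defs.v *)
From HB Require Import structures.
From mathcomp Require Import all_boot all_order all_algebra.
From mathcomp Require Import all_classical all_reals.
From mathcomp Require Import exp.
From mathcomp Require Import -(notations) mpoly.

Set Implicit Arguments.
Unset Strict Implicit.
Unset Printing Implicit Defensive.

Import Order.TTheory GRing.Theory Num.Theory.

Local Open Scope classical_set_scope.
Local Open Scope ring_scope.

(* 0 by convention when the minimum (resp. maximum) does not exist. *)
Definition set_min (X : set nat) : nat :=
  xget 0%N [set k | X k /\ forall j, X j -> (k <= j)%N].

Definition set_max (X : set nat) : nat :=
  xget 0%N [set k | X k /\ forall j, X j -> (j <= k)%N].

Section Groups.
Variable G : groupType.
Implicit Types (N H S : set G) (g h : G).

Definition is_subgroup H : Prop :=
  [/\ H 1%g, forall g h, H g -> H h -> H (g * h)%g & forall g, H g -> H g^-1%g].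

Definition is_normal N : Prop :=
  is_subgroup N /\ forall g h, N g -> N (g ^ h)%g.

Definition lcosets N : set (set G) :=
  range (fun g => [set h | N (g^-1 * h)%g]).

Definition has_index N (k : nat) : Prop := (lcosets N #= `I_k)%card.

Definition generates S : Prop := smallest is_subgroup S = [set: G].

Definition is_word S (s : seq G) : Prop :=
  forall x, x \in s -> S x \/ S x^-1%g.

Definition word_norm S g : nat :=
  set_min [set k | exists s : seq G,
    [/\ size s = k, is_word S s & (\prod_(x <- s) x)%g = g]].

(* Only finite-index subgroups contribute to the minimum, since an infinite
   index is larger than every natural number. *)
Definition divisibility g : nat :=
  set_min [set k | exists N : set G, [/\ is_normal N, ~ N g & has_index N k]].

Definition RF (R : realType) S (r : R) : nat :=
  set_max [set k | exists g : G,
    [/\ g <> 1%g, (word_norm S g)%:R <= r & k = divisibility g]].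

End Groups.

(* Only the values of f and g on [1, +oo) matter: r >= 1 and C * r >= 1. *)
Definition preceq (R : realType) (f g : R -> R) : Prop :=
  exists2 C : R, 0 < C &
    forall r : R, Num.max 1 C^-1 <= r -> f r <= C * g (C * r).

Definition is_ideal (K : comNzRingType) (I : set K) : Prop :=
  [/\ I 0, forall a b, I a -> I b -> I (a + b) & forall a b, I b -> I (a * b)].

Definition ideal_gen (K : comNzRingType) (X : set K) : set K :=
  smallest (@is_ideal K) X.

Definition minors (K : comNzRingType) (p q d : nat) (M : 'M[K]_(p, q)) : set K :=
  [set c | exists (f : 'I_d -> 'I_p) (g : 'I_d -> 'I_q),
    [/\ {homo f : i j / (i < j)%N}, {homo g : i j / (i < j)%N}
      & c = \det (mxsub f g M)]].

Definition minor_ideal (K : comNzRingType) (p q d : nat) (M : 'M[K]_(p, q)) :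
  set K := ideal_gen (minors d M).

(* [Zpoly n] is {mpoly int[n]} and [xvar i] is 'X_i: the notations of mpoly are
   incompatible with those of mathcomp-analysis and are not imported. *)
Notation Zpoly n := (mpoly.mpoly n int).

Definition xvar (n : nat) (i : 'I_n) : Zpoly n :=
  mpoly.mpolyX int (mpoly.mnm1 i).

Definition generic_mx (m n : nat) (A : 'I_n -> 'M[int]_m) : 'M[Zpoly n]_m :=
  \sum_(i < n) xvar i *: map_mx (@mpoly.mpolyC n int) (A i).

Definition linear_form (n : nat) (v : 'cV[int]_n) : Zpoly n :=
  \sum_(i < n) v i 0 *: xvar i.

Definition given_by (m n : nat)
    (phi : 'cV[int]_m -> 'cV[int]_m -> 'cV[int]_n) (A : 'I_n -> 'M[int]_m) :=
  forall w w', phi w w' = \col_i (w^T *m A i *m w') 0 0.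

Definition alternating (m n : nat)
    (phi : 'cV[int]_m -> 'cV[int]_m -> 'cV[int]_n) : Prop :=
  forall w w', phi w w' = - phi w' w.

Definition is_add_subgroup (V : zmodType) (H : set V) : Prop :=
  H 0 /\ forall u v, H u -> H v -> H (u - v).

Definition finite_add_index (V : zmodType) (H : set V) : Prop :=
  finite_set (range (fun u => [set v | H (v - u)])).

Definition full (m n : nat)
    (phi : 'cV[int]_m -> 'cV[int]_m -> 'cV[int]_n) : Prop :=
  finite_add_index
    (smallest (@is_add_subgroup 'cV[int]_n) [set v | exists w w', v = phi w w']).

(* The diagonal is kept; it vanishes when A is skew-symmetric over the
   integers. *)
Definition lower_mx (m : nat) (A : 'M[int]_m) : 'M[int]_m :=
  \matrix_(i, j) if (j <= i)%N then A i j else 0.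

Definition phiL (m n : nat) (A : 'I_n -> 'M[int]_m) (w w' : 'cV[int]_m) :
  'cV[int]_n := \col_i (w^T *m lower_mx (A i) *m w') 0 0.

Definition Gphi (m n : nat) (A : 'I_n -> 'M[int]_m) : Type :=
  ('cV[int]_m * 'cV[int]_n)%type.

Section GphiGroup.
Variables (m n : nat) (A : 'I_n -> 'M[int]_m).

Definition Gphi_mul (g h : Gphi A) : Gphi A :=
  (g.1 + h.1, g.2 + h.2 + phiL A g.1 h.1).

Definition Gphi_one : Gphi A := (0, 0).

Definition Gphi_inv (g : Gphi A) : Gphi A :=
  (- g.1, - g.2 + phiL A g.1 g.1).

Lemma phiLE w w' i j :
  phiL A w w' i j = (w^T *m lower_mx (A i) *m w') 0 0.
Proof. by rewrite mxE. Qed.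

Lemma phiLDl w1 w2 w : phiL A (w1 + w2) w = phiL A w1 w + phiL A w2 w.
Proof.
apply/matrixP => i j.
by rewrite [RHS]mxE !phiLE linearD /= !mulmxDl mxE.
Qed.

Lemma phiLDr w w1 w2 : phiL A w (w1 + w2) = phiL A w w1 + phiL A w w2.
Proof. by apply/matrixP => i j; rewrite [RHS]mxE !phiLE mulmxDr mxE. Qed.

Lemma phiL0l w : phiL A 0 w = 0.
Proof. by apply/matrixP => i j; rewrite mxE trmx0 !mul0mx !mxE. Qed.

Lemma phiL0r w : phiL A w 0 = 0.
Proof. by apply/matrixP => i j; rewrite mxE mulmx0 !mxE. Qed.

Lemma phiLNl w w' : phiL A (- w) w' = - phiL A w w'.
Proof. by apply/eqP; rewrite -addr_eq0 -phiLDl addNr phiL0l. Qed.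

Lemma phiLNr w w' : phiL A w (- w') = - phiL A w w'.
Proof. by apply/eqP; rewrite -addr_eq0 -phiLDr addNr phiL0r. Qed.

Lemma Gphi_mulA : associative Gphi_mul.
Proof.
move=> [w1 v1] [w2 v2] [w3 v3]; rewrite /Gphi_mul /= addrA; congr pair.
by rewrite phiLDl phiLDr !addrA [in LHS](addrAC _ _ (phiL A w1 w2))
  [in RHS](addrAC _ (phiL A w1 w2) v3) [in LHS](addrAC _ (phiL A w2 w3)).
Qed.

Lemma Gphi_mul1 : left_id Gphi_one Gphi_mul.
Proof. by move=> [w v]; rewrite /Gphi_mul /= phiL0l !add0r addr0. Qed.

Lemma Gphi_mulr1 : right_id Gphi_one Gphi_mul.
Proof. by move=> [w v]; rewrite /Gphi_mul /= phiL0r !addr0. Qed.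

Lemma Gphi_mulV : left_inverse Gphi_one Gphi_inv Gphi_mul.
Proof.
move=> [w v]; rewrite /Gphi_mul /Gphi_one /= phiLNl addNr; congr pair.
by rewrite addrAC addrK addNr.
Qed.

Lemma Gphi_mulrV : right_inverse Gphi_one Gphi_inv Gphi_mul.
Proof.
move=> [w v]; rewrite /Gphi_mul /Gphi_one /= phiLNr addrN; congr pair.
by rewrite addrA addrK addrN.
Qed.

HB.instance Definition _ := Choice.on (Gphi A).
HB.instance Definition _ := isGroup.Build (Gphi A)
  Gphi_mulA Gphi_mul1 Gphi_mulr1 Gphi_mulV Gphi_mulrV.

End GphiGroup.

(* Main.v *)
(** Take g = (0, l v) with l the product of the central binomial coefficients
    C(2^j, 2^(j-1)) for 1 <= j <= t: then log l = O(2^t), while every prime p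
    satisfies p^(v_p(l) + 1) > 2^t.  Let N be a normal subgroup of finite index
    avoiding g.  By the Smith normal form there are a prime power p^e and a
    surjective character chi : Z^n -> Z/p^e killing the central part of N but
    not l v, so that e > v_p(l) + a with a = v_p(chi v).  The central part
    contributes at least p^e to the index.  Since N is normal, the projection of
    N to Z^m lies in the kernel of B = sum_i chi_i A_i modulo p^e.  Evaluating
    the ideal membership at chi produces a d x d minor of B of valuation at most
    d a, whence this kernel has index at least p^(d (e - a)).  Altogether the
    index of N is at least p^((d+1)(e-a)) > 2^(t(d+1)), and g has word norm
    O(l). *)

Require Import Defs.
From mathcomp Require Import all_boot all_order all_algebra.
From mathcomp Require Import all_classical all_reals.
From mathcomp Require Import exp.
From mathcomp Require Import -(notations) mpoly.
From mathcomp Require Import zify.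

Set Implicit Arguments.
Unset Strict Implicit.
Unset Printing Implicit Defensive.

Import Order.TTheory GRing.Theory Num.Theory.
Local Open Scope classical_set_scope.
Local Open Scope ring_scope.

(** * Central binomial coefficients and their prime valuations *)

(** By Legendre's formula the valuation is the sum over k of floor(2s/p^k) - 2 floor(s/p^k); all
    terms are non-negative and the one at k = i equals 1. *)
Lemma prime_dvd_central_bin (p i s : nat) :
  prime p -> (s < p ^ i <= s.*2)%N -> (p %| 'C(s.*2, s))%N.
Proof.
move=> p_pr /andP[lt_s le_2s].
have s_gt0 : (0 < s)%N.
  by case: s lt_s le_2s => // _; rewrite double0 leqn0 expn_eq0; case: p p_pr.
have s_le : (s <= s.*2)%N by rewrite -addnn leq_addr.
have C_gt0 : (0 < 'C(s.*2, s))%N by rewrite bin_gt0.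
have i_gt0 : (0 < i)%N by case: i lt_s {le_2s} => //; rewrite expn0 ltnS leqNgt s_gt0.
have i_le : (i < s.*2.+1)%N.
  by rewrite ltnS; apply: leq_trans (ltnW (ltn_expl i (prime_gt1 p_pr))) le_2s.
suff: (0 < logn p 'C(s.*2, s))%N by rewrite -pfactor_dvdn // expn1.
have := congr1 (logn p) (bin_fact s_le).
rewrite -{2}addnn addnK !lognM ?muln_gt0 ?fact_gt0 // !logn_fact //.
have -> : (\sum_(1 <= k < s.+1) s %/ p ^ k = \sum_(1 <= k < s.*2.+1) s %/ p ^ k)%N.
  rewrite [RHS](big_cat_nat (n := s.+1)) ?ltnS //= [X in (_ = _ + X)%N]big1_seq ?addn0 //.
  move=> k /andP[_]; rewrite mem_index_iota => /andP[lt_sk _]; apply: divn_small.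
  exact: ltn_trans lt_sk (ltn_expl k (prime_gt1 p_pr)).
rewrite -big_split /= => E.
rewrite -(ltn_add2r (\sum_(1 <= k < s.*2.+1) (s %/ p ^ k + s %/ p ^ k))) E add0n.
rewrite !(bigD1_seq i) ?iota_uniq ?mem_index_iota ?i_gt0 //=.
rewrite -addSn leq_add //.
  by rewrite divn_small // divn_gt0 ?expn_gt0 ?prime_gt0.
by apply: leq_sum => k _; rewrite -[s.*2]addnn divnD ?expn_gt0 ?prime_gt0 ?leq_addr.
Qed.

Definition central_bin_prod (t : nat) : nat :=
  \prod_(j < t) 'C((2 ^ j).*2, 2 ^ j).

Lemma central_bin_prod_gt0 t : (0 < central_bin_prod t)%N.
Proof. by rewrite prodn_gt0 // => j; rewrite bin_gt0 -addnn leq_addr. Qed.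

Lemma central_bin_prodS t :
  central_bin_prod t.+1 = (central_bin_prod t * 'C((2 ^ t).*2, 2 ^ t))%N.
Proof. by rewrite /central_bin_prod big_ord_recr. Qed.

Lemma bin_le_exp2 a b : ('C(a, b) <= 2 ^ a)%N.
Proof.
case: (leqP b a) => [le_ba|/bin_small->//].
have := expnDn 1 1 a; rewrite addn1 => ->.
rewrite (bigD1 (Ordinal (le_ba : b < a.+1)%N)) //= !exp1n !muln1.
exact: leq_addr.
Qed.

(** The factor at j is at most 2^(2^(j+1)), and these exponents form a geometric sum. *)
Lemma central_bin_prod_le t : (central_bin_prod t <= 2 ^ (2 ^ t.+1))%N.
Proof.
elim: t => [|t IH]; first by rewrite /central_bin_prod big_ord0.
rewrite central_bin_prodS (leq_trans (leq_mul IH (bin_le_exp2 _ _))) //.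
by rewrite -expnD -mul2n -expnS addnn -mul2n -expnS.
Qed.

(* Doubling 2^t passes at most one new power of p, and that power divides the
   next central binomial coefficient; so the product replaces lcm(1..2^t). *)
Lemma central_bin_prod_logn p t : prime p ->
  (2 ^ t < p ^ (logn p (central_bin_prod t)).+1)%N.
Proof.
move=> p_pr; have [p_gt0 p_gt1] := (prime_gt0 p_pr, prime_gt1 p_pr).
elim: t => [|t IH].
  by rewrite expn0 expnS (leq_trans p_gt1) // leq_pmulr // expn_gt0 p_gt0.
have C_gt0 : (0 < 'C((2 ^ t).*2, 2 ^ t))%N by rewrite bin_gt0 -addnn leq_addr.
rewrite central_bin_prodS lognM ?central_bin_prod_gt0 // expnS mul2n.
set e := logn p (central_bin_prod t) in IH *.
case: (ltnP (2 ^ t).*2 (p ^ e.+1)) => [lt|le].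
  by apply: leq_trans lt _; rewrite leq_exp2l // ltnS leq_addr.
have /(prime_dvd_central_bin p_pr) pC : (2 ^ t < p ^ e.+1 <= (2 ^ t).*2)%N by rewrite IH.
rewrite -(expn1 p) pfactor_dvdn // in pC.
have: (p ^ e.+2 <= p ^ (e + logn p 'C((2 ^ t).*2, 2 ^ t)).+1)%N.
  by rewrite leq_exp2l // ltnS -addn1 leq_add2l.
apply: leq_trans; rewrite expnS -mul2n.
by apply: leq_trans (leq_mul p_gt1 (leqnn _)); rewrite ltn_pmul2l.
Qed.

(** * Subgroups of Z^n, characters and the Smith normal form *)

Section SubgroupClosure.
Variables (V : zmodType) (H : set V).
Hypothesis H_sub : is_add_subgroup H.

Lemma add_subgroupN x : H x -> H (- x).
Proof. by case: H_sub => H0 HB Hx; rewrite -sub0r; apply: HB. Qed.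

Lemma add_subgroupD x y : H x -> H y -> H (x + y).
Proof.
by case: H_sub => _ HB Hx Hy; rewrite -[y]opprK; apply: HB => //; apply: add_subgroupN.
Qed.

Lemma add_subgroup_sum (I : finType) (F : I -> V) :
  (forall i, H (F i)) -> H (\sum_i F i).
Proof.
by move=> HF; apply: (big_ind H) => //; [case: H_sub | apply: add_subgroupD].
Qed.

Lemma add_subgroupMn x k : H x -> H (x *+ k).
Proof.
move=> Hx; elim: k => [|k IH]; first by case: H_sub.
by rewrite mulrS; apply: add_subgroupD.
Qed.

Lemma add_subgroupMz x (a : int) : H x -> H (x *~ a).
Proof.
by move=> Hx; case: a => k; rewrite ?NegzE ?mulrNz;
  [|apply: add_subgroupN]; apply: add_subgroupMn.
Qed.

End SubgroupClosure.

Lemma add_subgroup_mulmx n s (H : set 'cV[int]_n) (M : 'M[int]_(n, s)) y :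
  is_add_subgroup H -> (forall j, H (col j M)) -> H (M *m y).
Proof.
move=> H_sub HM; suff -> : M *m y = \sum_j (col j M) *~ (y j 0).
  by apply: add_subgroup_sum => // j; apply: add_subgroupMz.
apply/matrixP=> i j; rewrite !mxE summxE; apply: eq_bigr => k _.
by rewrite ord1 -scaler_int intz !mxE mulrC.
Qed.

Lemma dvdz_mulmxl m n p (D : int) (X : 'M[int]_(m, n)) (Y : 'M[int]_(n, p)) :
  (forall i j, (D %| X i j)%Z) -> forall i j, (D %| (X *m Y) i j)%Z.
Proof.
by move=> DX i j; rewrite mxE rpred_sum // => k _; rewrite dvdz_mulr.
Qed.

Lemma mul_smith_mx m n p (s : seq int) (X : 'M[int]_(n, p)) (i : 'I_m) k :
  ((\matrix_(i < m, j < n) (s`_i *+ (i == j :> nat))) *m X) i k =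
  if insub (val i) is Some j then s`_i * X j k else 0.
Proof.
rewrite mxE; case: insubP => [j _ ij|ni].
  rewrite (bigD1 j) //= mxE ij eqxx big1 ?addr0 // => l lj.
  by rewrite mxE -ij -val_eqE /= eq_sym in lj *; rewrite (negPf lj) mul0r.
apply: big1 => l _; rewrite mxE; case: eqP => [il|_]; last by rewrite mul0r.
by rewrite /= il ltn_ord in ni.
Qed.

Lemma residue_decomposition n q (x : 'cV[int]_n) : (0 < q)%N ->
  exists (w : 'cV[int]_n) (h : {ffun 'I_n -> 'I_q}),
    x = w *+ q + \col_i (h i : nat)%:Z.
Proof.
move=> q_gt0; have q_neq0 : q%:Z != 0 by case: q q_gt0.
pose a i : int := x i 0.
have ltq i : (`|(a i %% q)%Z| < q)%N.
  by rewrite -ltz_nat gez0_abs ?modz_ge0 ?ltz_mod.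
exists (\col_i (a i %/ q)%Z), [ffun i => Ordinal (ltq i)].
apply/colP => i; rewrite mxE mulmxnE !mxE ffunE /= gez0_abs ?modz_ge0 //.
by rewrite -/(a i) {1}(divz_eq (a i) q) -mulr_natr natz.
Qed.

(** H contains q Z^n, so it is generated by the q e_i and the residue vectors lying in H; the
    columns of the other residues are set to 0. Having at least n columns gives every row a diagonal
    entry in the Smith form. *)
Lemma finite_exponent_image n (H : set 'cV[int]_n) (q : nat) :
  is_add_subgroup H -> (0 < q)%N -> (forall x, H (x *+ q)) ->
  exists s (M : 'M[int]_(n, n + s)), forall x, H x <-> exists y, x = M *m y.
Proof.
move=> H_sub q_gt0 Hq; pose F := {ffun 'I_n -> 'I_q}.
pose vec (h : F) : 'cV[int]_n := \col_i (h i : nat)%:Z.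
pose C := \matrix_(i < n, j < #|F|)
  if `[<H (vec (enum_val j))>] then vec (enum_val j) i 0 else 0.
exists #|F|, (row_mx q%:R%:M C) => x; split=> [Hx|[y ->]]; last first.
  apply: add_subgroup_mulmx => // j; case: (split_ordP j) => k ->.
    rewrite colKl; have -> : col k (q%:R%:M : 'M[int]_n) = delta_mx k 0 *+ q.
      apply/matrixP => a b; rewrite mulmxnE !mxE ord1 andbT.
      by case: (a == k); rewrite ?mulr1n ?mulr0n ?mul0rn.
    exact: Hq.
  rewrite colKr; case: (pselect (H (vec (enum_val k)))) => Hk.
    suff -> : col k C = vec (enum_val k) by [].
    by apply/colP => a; rewrite !mxE asboolT // mxE.
  suff -> : col k C = 0 by case: H_sub.
  by apply/colP => a; rewrite !mxE asboolF.
have [w [h xE]] := residue_decomposition x q_gt0.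
rewrite -/(vec h) in xE.
have Hh : H (vec h).
  by rewrite -(addrK (w *+ q) (vec h)) [_ + w *+ q]addrC -xE; case: H_sub => _; apply.
exists (col_mx w (delta_mx (enum_rank h) 0)).
rewrite mul_row_col mul_scalar_mx -colE {1}xE scaler_nat; congr (_ + _).
by apply/colP => i; rewrite [RHS]mxE [RHS]mxE enum_rankK asboolT.
Qed.

Lemma eqn_dvd_dist (q a b : nat) :
  (q %| `|a%:Z - b%:Z|)%N -> (a < q)%N -> (b < q)%N -> a = b.
Proof. by case: (posnP `|a%:Z - b%:Z|%N) => [|/dvdn_leq le /le]; lia. Qed.

(** In Smith coordinates H is the product of the c_i Z, so g violates the condition at some i. Then
    chi is row i of L^-1, u is column i of L and D = |c_i|; D is non-zero because q u lies in H and
    chi(q u) = q. *)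
Lemma separating_character n (H : set 'cV[int]_n) (q : nat) (g : 'cV[int]_n) :
  is_add_subgroup H -> (0 < q)%N -> (forall x, H (x *+ q)) -> ~ H g ->
  exists (D : nat) (chi : 'rV[int]_n) (u : 'cV[int]_n),
    [/\ (0 < D)%N, (chi *m u) 0 0 = 1,
        forall x, H x -> (D %| ((chi *m x) 0 0)%R)%Z
      & ~~ (D %| ((chi *m g) 0 0)%R)%Z].
Proof.
move=> H_sub q_gt0 Hq nHg.
have [s [M HM]] := finite_exponent_image H_sub q_gt0 Hq.
have [L L_unit [Rm R_unit [c _ ME]]] := int_Smith_normal_form M.
set Dm := \matrix_(_, _) _ in ME.
have rowE i x : (row i (invmx L) *m x) 0 0 = (invmx L *m x) i 0.
  by rewrite -row_mul mxE.
have dvdH i x : H x -> (c`_i %| ((row i (invmx L) *m x) 0 0)%R)%Z.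
  move=> /HM[y ->]; rewrite rowE ME -!mulmxA mulKmx // mul_smith_mx.
  by case: insub => [j|]; rewrite ?dvdz0 // dvdz_mulr.
have [i ndvd] : exists i, ~~ (c`_(val i) %| ((invmx L *m g) i 0)%R)%Z.
  apply: contrapT => nex; apply: nHg; apply/HM.
  (* If every c_j divided its coordinate, the quotients would give a preimage of g under M. *)
  pose z : 'cV[int]_n := \col_j (((invmx L *m g) j 0)%R %/ c`_j)%Z.
  exists (invmx Rm *m col_mx z 0).
  rewrite ME !mulmxA mulmxK // -[LHS](mulKVmx L_unit g) -mulmxA; congr (_ *m _).
  apply/colP => j; rewrite mul_smith_mx insubT /=; first by rewrite ltn_addr.
  move=> lt_j; rewrite (_ : Sub _ _ = lshift s j); last exact: val_inj.
  rewrite col_mxEu [z _ _]mxE mulrC divzK //.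
  by apply/negPn/negP => ndvd; apply: nex; exists j.
have chiu : (row i (invmx L) *m col i L) 0 0 = 1.
  by rewrite rowE colE mulmxA mulVmx // mul1mx !mxE !eqxx.
exists (absz c`_i), (row i (invmx L)), (col i L); split=> //.
- rewrite absz_gt0; apply/eqP => ci0.
  have := dvdH i _ (Hq (col i L)).
  rewrite -scaler_nat -scalemxAr mxE chiu mulr1 ci0 dvd0z pnatr_eq0.
  by rewrite -leqn0 leqNgt q_gt0.
- by move=> x /(dvdH i); rewrite !dvdzE.
- by rewrite rowE; move: ndvd; rewrite !dvdzE.
Qed.

(* The rows f x represent distinct classes modulo {y | y B = 0 mod p^e}; in
   Smith coordinates the i-th entry ranges over Z/p^(e - v_p(s_i)). *)
Lemma coset_representatives d (B : 'M[int]_d) (p e c : nat) :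
  prime p -> \det B != 0 -> (logn p `|\det B| <= c)%N ->
  exists (T : finType) (f : T -> 'rV[int]_d),
    (p ^ (d * e - c) <= #|T|)%N /\
    forall x y, (forall j, ((p ^ e)%N %| (((f x - f y) *m B) 0 j)%R)%Z) -> x = y.
Proof.
move=> p_pr detB_neq0 logn_le.
have [L L_unit [Rm R_unit [s _ BE]]] := int_Smith_normal_form B.
set Dm := \matrix_(_, _) _ in BE.
have DmE : Dm = diag_mx (\row_i s`_i).
  by apply/matrixP => i j; rewrite !mxE.
have abs_unit (X : 'M[int]_d) : X \in unitmx -> `|\det X|%N = 1%N.
  move=> X_unit; have := congr1 (fun Y => `|\det Y|%N) (mulmxV X_unit).
  by rewrite det_mulmx det1 abszM => /eqP; rewrite muln_eq1 => /andP[/eqP].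
pose t (i : 'I_d) : nat := absz s`_i.
have detB : `|\det B|%N = (\prod_(i < d) t i)%N.
  rewrite BE DmE !det_mulmx !abszM (abs_unit L) // (abs_unit Rm) // mul1n muln1 det_diag.
  by rewrite (big_morph absz abszM (erefl _)); apply: eq_bigr => i _; rewrite mxE.
pose cc (i : 'I_d) := logn p (t i).
have s_gt0 (i : 'I_d) : (0 < t i)%N.
  rewrite lt0n; apply: contra detB_neq0 => si0.
  by rewrite -absz_eq0 detB (bigD1 i) //= (eqP si0) mul0n.
have sum_cc : (\sum_(i < d) cc i <= c)%N.
  rewrite (leq_trans _ logn_le) // detB.
  suff [-> _] : logn p (\prod_(i < d) t i)%N = (\sum_(i < d) cc i)%N /\
      (0 < \prod_(i < d) t i)%N by [].
  apply: (big_ind2 (fun a b => logn p a = b /\ (0 < a)%N)); rewrite ?logn1 //.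
  by move=> a1 b1 a2 b2 [<- a1_gt0] [<- a2_gt0]; rewrite lognM // muln_gt0 a1_gt0.
exists {dffun forall i : 'I_d, 'I_(p ^ (e - cc i))}.
pose X (x : {dffun forall i : 'I_d, 'I_(p ^ (e - cc i))}) := \row_i (x i : nat)%:Z.
exists (fun x => X x *m invmx L); split.
  rewrite card_dep_ffun foldrE big_image /=.
  under eq_bigr do rewrite card_ord.
  (* The bound e <= cc i + (e - cc i) survives truncated subtraction, so entries with cc i > e need
     no separate case. *)
  rewrite -expn_sum leq_exp2l ?prime_gt1 // leq_subLR.
  rewrite (leq_trans _ (leq_add sum_cc (leqnn _))) // -big_split /=.
  have -> : (d * e = \sum_(i < d) e)%N by rewrite sum_nat_const card_ord.
  by apply: leq_sum => i _; rewrite -leq_subLR.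
move=> x y dvd_xy; apply/ffunP => i; apply: val_inj => /=.
have dvd_XD j : ((p ^ e)%N %| (((X x - X y) *m Dm) 0 j)%R)%Z.
  rewrite -[_ *m Dm](mulmxK R_unit).
  apply: dvdz_mulmxl => k l; rewrite ord1; have := dvd_xy l.
  by rewrite BE -mulmxBl !mulmxA mulmxKV.
have := dvd_XD i; rewrite DmE mul_mx_diag !mxE dvdzE abszM => dvd_i.
(* Cancelling the factor s_i costs exactly its valuation cc i; a zero difference is set apart
   because [logn] is 0 there. *)
have {}dvd_i : (p ^ (e - cc i) %| `|(x i : nat)%:Z - (y i : nat)%:Z|)%N.
  move: (_ - _ : int) dvd_i => z; case: (posnP `|z|%N) => [->//|z_gt0].
  rewrite !pfactor_dvdn ?muln_gt0 ?z_gt0 ?s_gt0 //.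
  by rewrite lognM ?s_gt0 // leq_subLR addnC.
exact: eqn_dvd_dist dvd_i (ltn_ord _) (ltn_ord _).
Qed.

(** * Coset counting and commutators in G_phi *)

Lemma card_le_index (G : groupType) (N : set G) k (T : finType) (f : T -> G) :
  N 1%g -> has_index N k -> (forall x y, N ((f x)^-1 * f y)%g -> x = y) ->
  (#|T| <= k)%N.
Proof.
move=> N1 /card_eqPle[/pcard_leP[F] _] f_inj.
pose c x : set G := [set h | N ((f x)^-1 * h)%g].
have lt_c x : (F (c x) < k)%N by apply: (@funS _ _ _ _ F); exists (f x).
rewrite -[k]card_ord; apply: (@leq_card _ _ (fun x => Ordinal (lt_c x))) => x y.
move=> [/(inj (f := F))] E; apply: f_inj.
have {}E : c x = c y by apply: E; rewrite inE; [exists (f x)|exists (f y)].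
have : c x (f y) by rewrite E /c /= mulVg.
by [].
Qed.

Section GphiNormal.
Variables (m n : nat) (A : 'I_n -> 'M[int]_m).
Hypothesis A_skew : forall i, (A i)^T = - A i.
Implicit Types (w : 'cV[int]_m) (u : 'cV[int]_n) (N : set (Gphi A)).

(** The Gram matrix of the alternating form chi o phi, that is, M_x specialised at x = chi. *)
Definition chi_form (chi : 'rV[int]_n) : 'M[int]_m := \sum_i chi 0 i *: A i.

(** Skew-symmetry gives A_i = L_i - L_i^T with L_i the lower part, so antisymmetrising phi^L
    recovers phi. *)
Lemma phiL_commutator chi w w' :
  chi *m (phiL A w w' - phiL A w' w) = w^T *m chi_form chi *m w'.
Proof.
have AE i : A i = lower_mx (A i) - (lower_mx (A i))^T.
  apply/matrixP => a b; have := congr1 (fun X : 'M_m => X a b) (A_skew i).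
  rewrite !mxE => skew; case: (ltngtP (a : nat) b) => [_|_|/val_inj ab].
  - by rewrite skew sub0r opprK.
  - by rewrite subr0.
  - by move: skew; rewrite ab; move: (A i b b) => x; lia.
have tr (X : 'M[int]_1) : X 0 0 = X^T 0 0 by rewrite mxE.
have subE p q (X Y : 'M[int]_(p, q)) a b : (X - Y) a b = X a b - Y a b.
  by rewrite !mxE.
have phiLB i : (phiL A w w' - phiL A w' w) i 0 = (w^T *m A i *m w') 0 0.
  rewrite (AE i) mulmxBr mulmxBl !subE !phiLE.
  by rewrite [X in - X](tr (w'^T *m _ *m w)) !trmx_mul trmxK mulmxA.
rewrite /chi_form mulmx_sumr mulmx_suml; apply/matrixP => a b.
rewrite !ord1 summxE mxE; apply: eq_bigr => i _.
by rewrite -scalemxAr -scalemxAl phiLB [in RHS]mxE.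
Qed.

Lemma Gphi_mulE (g h : Gphi A) : (g * h)%g = Gphi_mul g h.
Proof. by []. Qed.

Lemma Gphi_expgE u k : (((0, u) : Gphi A) ^+ k)%g = (0, u *+ k).
Proof.
elim: k => [//|k IH]; rewrite expgS IH Gphi_mulE /Gphi_mul /=.
by rewrite addr0 phiL0l addr0 mulrS.
Qed.

(** After multiplication by hg on the left the claim compares gh with hg, which differ only in the
    cocycle term. *)
Lemma Gphi_commutator (g h : Gphi A) :
  (g^-1 * (g ^ h))%g = (0, phiL A g.1 h.1 - phiL A h.1 g.1).
Proof.
apply: (mulgI (h * g)%g).
have -> : (h * g * (g^-1 * (g ^ h)) = g * h)%g.
  by rewrite /conjg !mulgA mulgK mulgV mul1g.
rewrite !Gphi_mulE /Gphi_mul /= phiL0r !addr0 (addrC h.1) (addrC h.2).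
by rewrite -[in RHS]addrA (addrC (phiL A h.1 g.1)) subrK.
Qed.

(** This turns normality into a constraint on the projection of N to Z^m: every phi(w, w') is a
    central element of N. *)
Lemma normal_commutator N w u w' : is_normal N -> N (w, u) ->
  N (0, phiL A w w' - phiL A w' w).
Proof.
move=> [[_ NM NV] NJ] Nwu.
have := NM _ _ (NV _ Nwu) (NJ _ ((w', 0) : Gphi A) Nwu).
by rewrite Gphi_commutator.
Qed.

End GphiNormal.

(** * Evaluating the ideal membership at a character *)

Lemma meval_generic_mx m n (A : 'I_n -> 'M[int]_m) (chi : 'rV[int]_n) :
  map_mx (meval (chi 0)) (generic_mx A) = chi_form A chi.
Proof.
rewrite /generic_mx /chi_form raddf_sum; apply: eq_bigr => i _.
by apply/matrixP => a b; rewrite !mxE /= mevalM mevalXU mevalC.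
Qed.

Lemma meval_linear_form n (v : 'cV[int]_n) (chi : 'rV[int]_n) :
  meval (chi 0) (linear_form v) = (chi *m v) 0 0.
Proof.
rewrite mxE raddf_sum; apply: eq_bigr => i _.
by rewrite /= mevalZ mevalXU mulrC.
Qed.

(** Let a = v_p(chi v). The polynomials whose value at chi is divisible by p^(da+1) form an ideal.
    If it contained all minors it would contain the power of the linear form, whose value (chi v)^d
    has valuation exactly da. *)
Lemma minor_small_logn m n d (A : 'I_n -> 'M[int]_m) (v : 'cV[int]_n)
    (chi : 'rV[int]_n) p :
  minor_ideal d (generic_mx A) (linear_form v ^+ d) -> prime p ->
  (chi *m v) 0 0 != 0 ->
  exists f g : 'I_d -> 'I_m, let B := mxsub f g (chi_form A chi) in
    \det B != 0 /\ (logn p `|\det B| <= d * logn p `|(chi *m v) 0%R 0%R|)%N.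
Proof.
move=> Iv p_pr chiv_neq0; set a := logn p _; apply: contrapT => none.
pose J : set (Zpoly n) := [set P | (((p ^ (d * a).+1)%N : int) %| meval (chi 0%R) P)%Z].
have J_ideal : is_ideal J.
  split; rewrite /J /=.
  - by rewrite meval0 dvdz0.
  - by move=> P Q dP dQ; rewrite mevalD; apply: rpredD.
  - by move=> P Q dQ; rewrite mevalM dvdz_mull.
have minors_J : minors d (generic_mx A) `<=` J.
  move=> c [f [g [_ _ ->]]]; rewrite /J /= -det_map_mx map_mxsub meval_generic_mx.
  apply: contrapT => /negP ndvd; apply: none; exists f, g.
  have det_neq0 : \det (mxsub f g (chi_form A chi)) != 0.
    by apply: contra ndvd => /eqP->; rewrite dvdz0.
  split=> //; rewrite leqNgt; apply: contra ndvd => lt_a.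
  by rewrite dvdzE /= pfactor_dvdn // absz_gt0.
have := Iv J (conj J_ideal minors_J); rewrite /J /= rmorphXn /= meval_linear_form.
rewrite dvdzE abszX /= pfactor_dvdn ?expn_gt0 ?absz_gt0 ?chiv_neq0 //.
by rewrite lognX ltnn.
Qed.

(** * The lower bound for the index *)

Lemma Gphi_central_index_bound m n d (A : 'I_n -> 'M[int]_m)
    (v : 'cV[int]_n) (l b k : nat) (N : set (Gphi A)) :
  (forall i, (A i)^T = - A i) ->
  minor_ideal d (generic_mx A) (linear_form v ^+ d) ->
  (0 < l)%N -> (forall p, prime p -> (b < p ^ (logn p l).+1)%N) ->
  is_normal N -> has_index N k -> ~ N (0, v *+ l) -> (b ^ d.+1 <= k)%N.
Proof.
move=> A_skew Iv l_gt0 lt_b N_normal N_index nNg.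
have [[N1 NM NV] NJ] := N_normal.
have NB g h : N g -> N h -> N (g^-1 * h)%g by move=> /NV; apply: NM.
pose H : set 'cV[int]_n := [set u | N (0, u)].
have centralB w x y : (((w, x) : Gphi A)^-1 * (w, y) = (0, y - x) :> Gphi A)%g.
  apply: (mulgI ((w, x) : Gphi A)).
  by rewrite mulVKg Gphi_mulE /Gphi_mul /= phiL0r !addr0 addrC subrK.
have H_sub : is_add_subgroup H.
  by split=> // x y Hx Hy; rewrite /H /= -(centralB 0); apply: NB.
(* Two of the k+1 multiples 0, x, ..., kx lie in the same coset. *)
have Hq x : H (x *+ k`!).
  have [i [j [lt_ij le_jk Hij]]] :
      exists i j, [/\ (i < j)%N, (j <= k)%N & H (x *+ (j - i))].
    apply: contrapT => none; suff: (#|'I_k.+1| <= k)%N by rewrite card_ord ltnn.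
    apply: (card_le_index (f := fun i : 'I_k.+1 => (0, x *+ i) : Gphi A) _ N_index) => //.
    move=> i j; rewrite centralB => Hij; apply: val_inj.
    case: (ltngtP i j) => [lt_ij|lt_ji|//]; case: none.
      by exists i, j; split; [|by rewrite -ltnS ltn_ord|rewrite (mulrnBr _ (ltnW lt_ij))].
    exists j, i; split; [by []|by rewrite -ltnS ltn_ord|rewrite (mulrnBr _ (ltnW lt_ji))].
    by rewrite -opprB; apply: add_subgroupN.
  (* The difference j - i depends on x, but it is at most k, so k! is a common exponent. *)
  have /dvdnP[c ->] : (j - i %| k`!)%N.
    by apply: dvdn_fact; rewrite subn_gt0 lt_ij (leq_trans (leq_subr _ _)).
  by rewrite mulnC mulrnA; apply: add_subgroupMn.
have [D [chi [u [D_gt0 chiu dvdH ndvd]]]] :=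
  separating_character H_sub (fact_gt0 k) Hq nNg.
have chivE : (chi *m (v *+ l)) 0 0 = (chi *m v) 0 0 *+ l.
  by rewrite -scaler_nat -scalemxAr mxE mulr_natl.
set cv : int := (chi *m v) 0 0 in chivE.
have cv_neq0 : cv != 0.
  by apply: contra ndvd => /eqP cv0; rewrite chivE cv0 mul0rn dvdz0.
(* If the inequality failed at every prime, D would divide chi(l v). *)
have [p p_pr lt_logn] : exists2 p, prime p & (logn p `|cv| + logn p l < logn p D)%N.
  apply: contrapT => none; move/negP: ndvd; apply.
  rewrite chivE -mulr_natr natz dvdzE abszM /=.
  apply/dvdn_partP => // p; rewrite mem_primes => /and3P[p_pr _ _].
  rewrite p_part pfactor_dvdn ?muln_gt0 ?absz_gt0 ?cv_neq0 //.
  rewrite lognM ?absz_gt0 // leqNgt; apply/negP => lt; apply: none; by exists p.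
set a := logn p `|cv| in lt_logn; set e := logn p D in lt_logn.
have pe_dvd : (p ^ e %| D)%N by rewrite pfactor_dvdn.
have [f [g [det_neq0 logn_le]]] := minor_small_logn Iv p_pr cv_neq0.
set B := mxsub f g _ in det_neq0 logn_le.
have [T [rep [card_T rep_inj]]] := coset_representatives e p_pr det_neq0 logn_le.
(* [spread] sends y to the sum of the y_i e_(f i), so pairing it with e_(g j) under chi o phi yields
   the j-th entry of y B. The multiples of u add p^e central classes, told apart by chi u = 1. *)
pose spread (y : 'rV[int]_d) : 'cV[int]_m := (y *m rowsub f 1%:M)^T.
pose F (tj : T * 'I_(p ^ e)) : Gphi A := (spread (rep tj.1), u *+ tj.2).
have : (#|{: T * 'I_(p ^ e)}| <= k)%N.
  apply: (card_le_index (f := F) N1 N_index) => -[t i] [t' i'] NF.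
  have t_eq : t' = t.
    apply: rep_inj => j.
    pose w := (spread (rep t' - rep t)).
    (* Only the first component w of the quotient matters, since commutators ignore the central
       one. *)
    have [z NFw] : exists z, N (w, z).
      exists ((((F (t, i))^-1 * F (t', i'))%g : Gphi A).2).
      suff -> : w = ((((F (t, i))^-1 * F (t', i'))%g : Gphi A).1).
        by rewrite -surjective_pairing.
      by rewrite /w /F /spread /= mulmxBl linearB /= addrC.
    have := dvdH _ (normal_commutator (delta_mx (g j) 0) N_normal NFw).
    rewrite (phiL_commutator A_skew) /w /spread trmxK.
    rewrite -(mulmxA (rep t' - rep t)) mul_rowsub_mx mul1mx -colE mxE => dvd_j.
    have pe_dvdz : ((p ^ e)%N %| D%:Z)%Z by [].
    apply: (dvdz_trans pe_dvdz).
    suff <- : ((rep t' - rep t) *m rowsub f (chi_form A chi)) 0 (g j) =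
      ((rep t' - rep t) *m B) 0 j by [].
    by rewrite !mxE; apply: eq_bigr => k' _; rewrite !mxE.
  move: NF; rewrite t_eq /F /= centralB => /dvdH.
  have chiuMn (j : nat) : (chi *m (u *+ j)) 0 0 = j.
    by rewrite -scaler_nat -scalemxAr mxE chiu mulr1 natz.
  rewrite mulmxBr mxE [X in _ + X]mxE !chiuMn dvdzE => dvd_i.
  congr pair; apply/esym/val_inj.
  exact: eqn_dvd_dist (dvdn_trans pe_dvd dvd_i) (ltn_ord _) (ltn_ord _).
rewrite card_prod card_ord; apply: leq_trans.
apply: leq_trans (leq_mul card_T (leqnn _)).
have p_gt0 := prime_gt0 p_pr.
(* Exponents: (d+1)(e - a) <= (de - da) + e. Then b < p^(v_p(l)+1) <= p^(e-a) by the choice of p. *)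
apply: (@leq_trans ((p ^ (e - a)) ^ d.+1)); last first.
  rewrite -expnM -expnD leq_exp2l ?prime_gt1 // mulnS addnC.
  by rewrite mulnC mulnBr leq_add // leq_subr.
rewrite leq_exp2r // (leq_trans (ltnW (lt_b p p_pr))) //.
by rewrite leq_exp2l ?prime_gt1 // ltn_subRL.
Qed.

(** * Word norms, balls and residual finiteness growth *)

Lemma set_minP (X : set nat) : (exists k, X k) ->
  X (set_min X) /\ forall j, X j -> (set_min X <= j)%N.
Proof.
move=> [k Xk]; have exX : exists k, `[<X k>] by exists k; apply/asboolP.
apply: (@xgetPex _ 0%N [set k | X k /\ forall j, X j -> (k <= j)%N]).
case: (ex_minnP exX) => i /asboolP Xi i_min; exists i; split=> // j Xj.
by apply: i_min; apply/asboolP.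
Qed.

(** Finiteness excludes the default value 0 of an unbounded set; for [RF] it comes from the
    finiteness of balls. *)
Lemma set_max_ge (X : set nat) k : finite_set X -> X k -> (k <= set_max X)%N.
Proof.
move=> /finite_seqP[s XE] Xk; have exX : exists k, `[<X k>] by exists k; apply/asboolP.
have bX i : `[<X i>] -> (i <= \max_(x <- s) x)%N.
  by move=> /asboolP; rewrite XE /= => si; apply: leq_bigmax_seq.
have [_ ] : X (set_max X) /\ forall j, X j -> (j <= set_max X)%N; last exact.
apply: (@xgetPex _ 0%N [set k | X k /\ forall j, X j -> (j <= k)%N]).
case: (ex_maxnP exX bX) => i /asboolP Xi i_max; exists i; split=> // j Xj.
by apply: i_max; apply/asboolP.
Qed.

Section WordNorm.
Variables (G : groupType) (S : set G).

Definition words_of_size (k : nat) : set G :=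
  [set g | exists s : seq G, [/\ size s = k, is_word S s & (\prod_(x <- s) x)%g = g]].

Lemma words_of_sizeM k l g h :
  words_of_size k g -> words_of_size l h -> words_of_size (k + l) (g * h)%g.
Proof.
move=> [s [<- s_word <-]] [t [<- t_word <-]]; exists (s ++ t).
split; [exact: size_cat| |by rewrite big_cat].
by move=> x; rewrite mem_cat => /orP[/s_word|/t_word].
Qed.

Lemma words_of_sizeX k l g : words_of_size k g -> words_of_size (l * k) (g ^+ l)%g.
Proof.
move=> kg; elim: l => [|l IH]; first by exists [::]; split; rewrite ?big_nil.
by rewrite expgS mulSn; apply: words_of_sizeM.
Qed.

Lemma words_of_size1 g : S g \/ S g^-1%g -> words_of_size 1 g.
Proof.
by move=> Sg; exists [:: g]; split; rewrite ?big_seq1 // => x; rewrite inE => /eqP->.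
Qed.

Lemma words_of_sizeV k g : words_of_size k g -> words_of_size k g^-1%g.
Proof.
move=> [s [<- s_word <-]]; elim: s s_word => [|x s IH] s_word.
  by rewrite big_nil invg1; exists [::]; split; rewrite ?big_nil.
rewrite big_cons invgM /= -addn1; apply: words_of_sizeM.
  by apply: IH => y sy; apply: s_word; rewrite inE sy orbT.
by apply: words_of_size1; rewrite invgK; case: (s_word x (mem_head _ _)); [right|left].
Qed.

Lemma generates_word g : generates S -> exists k, words_of_size k g.
Proof.
move=> S_gen; have : [set: G] g by []; rewrite -S_gen.
move=> /(_ [set h | exists k, words_of_size k h]); apply; split.
  split=> [|x y [k kx] [l ly]|x [k kx]].
  - by exists 0%N, [::]; split; rewrite ?big_nil.
  - by exists (k + l)%N; apply: words_of_sizeM.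
  - by exists k; apply: words_of_sizeV.
by move=> x Sx; exists 1%N; apply: words_of_size1; left.
Qed.

Lemma word_normP g : generates S -> words_of_size (word_norm S g) g /\
  forall k, words_of_size k g -> (word_norm S g <= k)%N.
Proof.
by move=> S_gen; apply: (@set_minP [set k | words_of_size k g]); apply: generates_word.
Qed.

Lemma word_normX g l : generates S -> (word_norm S (g ^+ l)%g <= l * word_norm S g)%N.
Proof.
move=> S_gen; apply: (word_normP _ S_gen).2; apply: words_of_sizeX.
exact: (word_normP g S_gen).1.
Qed.

Lemma finite_words_of_size k : finite_set S -> finite_set (words_of_size k).
Proof.
move=> S_fin; pose S' := S `|` (fun x => x^-1%g) @` S.
have S'_fin : finite_set S' by rewrite finite_setU; split=> //; apply: finite_image.
elim: k => [|k IH].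
  apply: (@sub_finite_set _ _ [set 1%g]); last exact: finite_set1.
  by move=> g [s [/size0nil-> _ <-]]; rewrite big_nil.
apply: sub_finite_set (finite_image2 (fun x y => (x * y)%g) S'_fin IH).
move=> g [[|x s] [// [sz] s_word <-]]; rewrite big_cons; exists x.
  case: (s_word x (mem_head _ _)); [by left|right].
  by exists x^-1%g; rewrite ?invgK.
exists (\prod_(y <- s) y)%g => //; exists s; split=> // y sy.
by apply: s_word; rewrite inE sy orbT.
Qed.

(** Since S generates, each norm is the length of an actual word; an integer bound for |r| leaves
    finitely many lengths, each with finitely many words. *)
Lemma finite_ball (R : realType) (r : R) :
  generates S -> finite_set S -> finite_set [set g | (word_norm S g)%:R <= r].
Proof.
move=> S_gen S_fin.
apply: (@sub_finite_set _ _ (\bigcup_(k in `I_(Num.bound `|r|).+1) words_of_size k)).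
  move=> g /= le_r; exists (word_norm S g); last exact: (word_normP g S_gen).1.
  rewrite /= ltnS -(ler_nat R) (le_trans le_r) // (le_trans (ler_norm r)) // ltW //.
  exact: archi_boundP.
by apply: bigcup_finite => [|k _]; [exact: finite_II|exact: finite_words_of_size].
Qed.

Lemma divisibility_le_RF (R : realType) (r : R) g :
  generates S -> finite_set S -> g <> 1%g -> (word_norm S g)%:R <= r ->
  (divisibility g <= RF S r)%N.
Proof.
move=> S_gen S_fin g_neq1 g_le; apply: set_max_ge; last by exists g.
apply: sub_finite_set (finite_image (@divisibility G) (finite_ball r S_gen S_fin)).
by move=> k [h [_ h_le ->]]; exists h.
Qed.

End WordNorm.

(** * Congruence subgroups and separation of central elements *)

Section Congruence.
Variables (m n : nat) (A : 'I_n -> 'M[int]_m).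

Lemma phiLMnl w w' k : phiL A (w *+ k) w' = phiL A w w' *+ k.
Proof. by elim: k => [|k IH]; rewrite ?phiL0l // !mulrS phiLDl IH. Qed.

Lemma phiLMnr w w' k : phiL A w (w' *+ k) = phiL A w w' *+ k.
Proof. by elim: k => [|k IH]; rewrite ?phiL0r // !mulrS phiLDr IH. Qed.

(** The kernel of reduction modulo q. These subgroups ensure that [divisibility] of a non-trivial
    central element (0, u) is a true minimum and not the default 0. *)
Definition congruence_subgroup (q : nat) : set (Gphi A) :=
  [set g | exists w u, g = (w *+ q, u *+ q)].

Lemma congruence_subgroup_normal q : is_normal (congruence_subgroup q).
Proof.
have NM g h : congruence_subgroup q g -> congruence_subgroup q h ->
    congruence_subgroup q (g * h)%g.
  move=> [w [u ->]] [w' [u' ->]]; rewrite Gphi_mulE /Gphi_mul /= phiLMnl -!mulrnDl.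
  by do 2!eexists.
split; first split=> //.
- by exists 0, 0; rewrite !mul0rn.
- move=> g [w [u ->]]; exists (- w), (- u + phiL A w (w *+ q)).
  by rewrite mulNrn mulrnDl mulNrn -phiLMnl.
move=> g h Ng; have -> : (g ^ h = g * (g^-1 * (g ^ h)))%g by rewrite mulVKg.
apply: (NM) => //.
rewrite Gphi_commutator; case: Ng => [w [u ->]] /=.
by exists 0, (phiL A w h.1 - phiL A h.1 w); rewrite mul0rn mulrnBl phiLMnl phiLMnr.
Qed.

Lemma congruence_subgroup_index q : (0 < q)%N ->
  exists k, has_index (congruence_subgroup q) k.
Proof.
move=> q_gt0; apply/finite_setP.
have [[N1 NM NV] _] := congruence_subgroup_normal q.
pose c (g : Gphi A) : set (Gphi A) := [set h | congruence_subgroup q (g^-1 * h)%g].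
pose rep (h : {ffun 'I_m -> 'I_q} * {ffun 'I_n -> 'I_q}) : Gphi A :=
  (\col_i (h.1 i : nat)%:Z, \col_i (h.2 i : nat)%:Z).
apply: (@sub_finite_set _ _ [set c (rep h) | h in setT]); last first.
  by apply: finite_image; apply: finite_finset.
move=> _ [g _ <-]; have [w [h1 wE]] := residue_decomposition g.1 q_gt0.
have [u [h2 uE]] := residue_decomposition g.2 q_gt0.
exists (h1, h2) => //; set r := rep _.
(* Subtracting phi^L(r.1, w) compensates the cocycle term of the product. *)
have gE : g = (r * ((w *+ q, (u - phiL A r.1 w) *+ q) : Gphi A))%g.
  rewrite Gphi_mulE /Gphi_mul /= phiLMnr mulrnBl addrA subrK.
  by rewrite [g]surjective_pairing wE uE; congr pair; apply: addrC.
have Nrg : congruence_subgroup q (r^-1 * g)%g.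
  by rewrite gE mulKg; do 2!eexists.
apply/seteqP; split=> x /= Nx.
  have := NM _ _ (NV _ Nrg) Nx; by rewrite invgM invgK -mulgA mulVKg.
by have := NM _ _ Nrg Nx; rewrite -mulgA mulVKg.
Qed.

(** A modulus exceeding a non-zero coordinate of u in absolute value cannot divide it. *)
Lemma central_separated (u : 'cV[int]_n) : u != 0 ->
  exists (N : set (Gphi A)) k, [/\ is_normal N, ~ N (0, u) & has_index N k].
Proof.
move=> u_neq0; have [i ui_neq0] : exists i, u i 0 != 0.
  apply: contrapT => none; case/eqP: u_neq0; apply/colP => i; rewrite mxE.
  by apply/eqP/negPn/negP => ?; apply: none; exists i.
pose q := `|u i 0%R|%N.+1.
have [k N_index] := congruence_subgroup_index (ltn0Sn `|u i 0%R|).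
exists (congruence_subgroup q), k; split=> //; first exact: congruence_subgroup_normal.
move=> [w [u' [_ uE]]]; have : (q %| `|u i 0%R|)%N.
  by rewrite uE mulmxnE -mulr_natl natz abszM dvdn_mulr.
by rewrite /dvdn modn_small ?ltnS // -/(dvdn _ _) absz_eq0 (negPf ui_neq0).
Qed.

End Congruence.

(** * Choice of t and the growth estimate *)

(** Take the largest t satisfying the first bound; the factor 4 makes t = 0 admissible already at r
    = 1. *)
Lemma two_power_bracket (R : realType) (r : R) : 1 <= r ->
  exists t, (2 ^ 2 ^ t.+1)%:R <= 4 * r /\ r <= (2 ^ 2 ^ t.+2)%:R.
Proof.
move=> r_ge1; pose P t := (2 ^ 2 ^ t.+1)%:R <= 4 * r.
have exP : exists t, P t by exists 0%N; rewrite /P; rewrite -[leLHS]mulr1 ler_wpM2l.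
have bP t : P t -> (t <= Num.bound (4 * r))%N.
  rewrite /P => le_r; rewrite -(ler_nat R) ltW //.
  apply: le_lt_trans (archi_boundP _); last by rewrite mulr_ge0 // (le_trans ler01).
  apply: le_trans le_r; rewrite ler_nat.
  apply: leq_trans (ltnW (ltn_expl _ _)) => //.
  by apply: leq_trans (ltnW (ltn_expl t.+1 _)).
case: (ex_maxnP exP bP) => t Pt t_max; exists t; split=> //.
rewrite leNgt; apply/negP => lt_r.
have /t_max : P t.+1.
  rewrite /P (le_trans (ltW lt_r)) // ler_peMl // ?(le_trans ler01) //.
  by rewrite ler1n.
by rewrite ltnn.
Qed.

Theorem theorem5p4 (R : realType) (m n d : nat)
    (phi : {bilinear 'cV[int]_m -> 'cV[int]_m -> 'cV[int]_n})
    (A : 'I_n -> 'M[int]_m)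
    (phi_full : full phi)
    (phi_alt : alternating phi)
    (A_skew : forall i, (A i)^T = - A i)
    (phi_A : given_by phi A)
    (d_gt0 : (0 < d)%N)
    (Hv : exists2 v : 'cV[int]_n, v != 0 &
       minor_ideal d (generic_mx A) (linear_form v ^+ d)) :
  forall S : set (Gphi A), finite_set S -> generates S ->
    preceq (fun r : R => ln r ^+ d.+1) (fun r : R => (RF S r)%:R).
Proof.
move=> S S_fin S_gen; have [v v_neq0 Iv] := Hv.
pose c := (word_norm S ((0, v) : Gphi A)).+1.
(* The factor 4c bounds the word norm, by l <= 4r; 4^(d+1) absorbs the constant in ln r <= 4 *
   2^t. *)
pose C : R := (4 * c * 4 ^ d.+1)%:R.
have C_gt0 : 0 < C by rewrite ltr0n !muln_gt0 expn_gt0.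
exists C => // r; rewrite ge_max => /andP[r_ge1 _].
have [t [le_4r r_le]] := two_power_bracket r_ge1.
have r_gt0 : 0 < r := lt_le_trans ltr01 r_ge1.
pose l := central_bin_prod t; pose g : Gphi A := (0, v *+ l).
have l_gt0 : (0 < l)%N := central_bin_prod_gt0 t.
have vl_neq0 : v *+ l != 0.
  apply: contra v_neq0 => /eqP vl0; apply/eqP/colP => i.
  have /eqP := congr1 (fun x : 'cV_n => x i 0) vl0.
  by rewrite mulmxnE !mxE mulrn_eq0 eqn0Ngt l_gt0 => /eqP.
have g_norm : (word_norm S g)%:R <= C * r.
  apply: (@le_trans _ _ ((2 ^ 2 ^ t.+1 * c)%:R)).
    rewrite ler_nat /g -Gphi_expgE (leq_trans (word_normX _ _ S_gen)) //.
    by rewrite leq_mul ?central_bin_prod_le.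
  apply: (@le_trans _ _ ((4 * r) * c%:R)); first by rewrite natrM ler_wpM2r.
  rewrite mulrAC ler_wpM2r ?(ltW r_gt0) // -natrM ler_nat leq_pmulr //.
  by rewrite expn_gt0.
have g_neq1 : g <> 1%g by case=> /eqP; rewrite (negPf vl_neq0).
have g_div : ((2 ^ t) ^ d.+1 <= divisibility g)%N.
  have [N [k Nk]] := central_separated A vl_neq0.
  (* The minimum is attained by some normal subgroup, to which the index bound applies with b =
     2^t. *)
  have [] := @set_minP [set k | exists N : set (Gphi A),
    [/\ is_normal N, ~ N g & has_index N k]]; first by exists k, N.
  move=> [N' [N'_normal N'g N'_index]] _.
  apply: Gphi_central_index_bound A_skew Iv l_gt0 _ N'_normal N'_index N'g => p.
  exact: central_bin_prod_logn.
have ln_le : ln r <= (4 * 2 ^ t)%:R.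
  apply: (@le_trans _ _ (ln ((2 ^ 2 ^ t.+2)%:R))).
    by rewrite ler_ln ?posrE // ltr0n expn_gt0.
  (* It remains to see ln 2 <= 1, the case x = 1 of ln(1 + x) <= x. *)
  rewrite natrX lnXn // (_ : (4 * 2 ^ t = 2 ^ t.+2)%N); last by rewrite !expnS mulnA.
  by rewrite ler_wMn2r // (_ : 2%:R = 1 + 1) // le_ln1Dx //
    (lt_trans _ (ltr01)) ?oppr_lt0.
apply: (@le_trans _ _ ((4 * 2 ^ t) ^ d.+1)%:R).
  by rewrite natrX lerXn2r ?nnegrE ?ler0n ?ln_ge0.
rewrite expnMn natrM ler_pM ?ler0n //.
  by rewrite ler_nat leq_pmull // muln_gt0.
by rewrite ler_nat (leq_trans g_div) // divisibility_le_RF.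
Qed.
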